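(* Let $I\subseteq\mathbb{R}$ be an interval, let $f:I\to\mathbb{R}$ be differentiable on the interior $I^{\circ}$, let $a,b\in I^{\circ}$ with $a<b$, assume $f'\in L[a,b]$, and let $\alpha,\lambda\in[0,1]$. Suppose that $|f'|^{q}$ is $s$-convex on $[a,b]$ for some fixed $s\in(0,1]$ and some $q>1$, and let $p$ satisfy $\frac1p+\frac1q=1$. Define $$I_f(\lambda,\alpha,a,b)=\lambda\big(\alpha f(a)+(1-\alpha)f(b)\big)+(1-\lambda)f(\alpha a+(1-\alpha)b)-\frac{1}{b-a}\int_a^b f(x)\,dx,$$ $$C_f(\alpha,q)=(1-\alpha)\big[|f'((1-\alpha)b+\alpha a)|^q+|f'(a)|^q\big],\qquad D_f(\alpha,q)=\alpha\big[|f'((1-\alpha)b+\alpha a)|^q+|f'(b)|^q\big],$$ $$\varepsilon_1(\alpha,\lambda,p)=(\alpha\lambda)^{p+1}+(1-\alpha-\alpha\lambda)^{p+1},\qquad \varepsilon_2(\alpha,\lambda,p)=(\alpha\lambda)^{p+1}-(\alpha\lambda-1+\alpha)^{p+1}.$$ Then $|I_f(\lambda,\alpha,a,b)|\leq (b-a)\left(\frac{1}{p+1}\right)^{1/p}\left(\frac{1}{s+1}\right)^{1/q}\cdot K$, where $K=\varepsilon_1^{1/p}(\alpha,\lambda,p)C_f^{1/q}(\alpha,q)+\varepsilon_1^{1/p}(1-\alpha,\lambda,p)D_f^{1/q}(\alpha,q)$ if $\alpha\lambda\leq 1-\alpha\leq 1-\lambda(1-\alpha)$; $K=\varepsilon_1^{1/p}(\alpha,\lambda,p)C_f^{1/q}(\alpha,q)+\varepsilon_2^{1/p}(1-\alpha,\lambda,p)D_f^{1/q}(\alpha,q)$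 if $\alpha\lambda\leq 1-\lambda(1-\alpha)\leq 1-\alpha$; $K=\varepsilon_2^{1/p}(\alpha,\lambda,p)C_f^{1/q}(\alpha,q)+\varepsilon_1^{1/p}(1-\alpha,\lambda,p)D_f^{1/q}(\alpha,q)$ if $1-\alpha\leq\alpha\lambda\leq 1-\lambda(1-\alpha)$.
   Context: For a fixed $s\in(0,1]$, a function $g:[a,b]\to[0,\infty)$ is called $s$-convex (in the second sense) on $[a,b]$ if $g(\theta x+(1-\theta)y)\leq \theta^{s}g(x)+(1-\theta)^{s}g(y)$ for all $x,y\in[a,b]$ and all $\theta\in[0,1]$. *)

(* Defs.v *)
From HB Require Import structures.
From mathcomp Require Import all_boot all_order all_algebra.
From mathcomp Require Import all_classical all_reals all_analysis.
Set Implicit Arguments. Unset Strict Implicit. Unset Printing Implicit Defensive.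
Import Order.TTheory GRing.Theory Num.Theory.
Import numFieldNormedType.Exports.
Local Open Scope classical_set_scope.
Local Open Scope ring_scope.

Definition sconvex_on (R : realType) (s : R) (g : R -> R) (a b : R) : Prop :=
  (forall x, x \in `[a, b] -> 0 <= g x) /\
  (forall x y t, x \in `[a, b] -> y \in `[a, b] -> 0 <= t -> t <= 1 ->
     g (t * x + (1 - t) * y) <= t `^ s * g x + (1 - t) `^ s * g y).

Definition eps1 (R : realType) (al la p : R) : R :=
  (al * la) `^ (p + 1) + (1 - al - al * la) `^ (p + 1).
Definition eps2 (R : realType) (al la p : R) : R :=
  (al * la) `^ (p + 1) - (al * la - 1 + al) `^ (p + 1).

Definition If (R : realType) (f : R -> R) (la al a b : R) : R :=
  la * (al * f a + (1 - al) * f b) + (1 - la) * f (al * a + (1 - al) * b)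
  - (b - a)^-1 * Rintegral lebesgue_measure `[a, b] f.

Definition Cf (R : realType) (f : R -> R) (al q a b : R) : R :=
  (1 - al) * (`|(derive1 f) ((1 - al) * b + al * a)| `^ q + `|(derive1 f) a| `^ q).
Definition Df (R : realType) (f : R -> R) (al q a b : R) : R :=
  al * (`|(derive1 f) ((1 - al) * b + al * a)| `^ q + `|(derive1 f) b| `^ q).

(* Main.v *)
(* Put L = b - a, m = alpha a + (1 - alpha) b, k1 = a + alpha lambda L and
   k2 = b - (1 - alpha) lambda L. Integration by parts gives
   L I_f = int_a^m (x - k1) f'(x) dx + int_m^b (x - k2) f'(x) dx.
   Each integral is bounded by Hoelder's inequality; the factor involving
   |f'|^q is controlled by the Hermite-Hadamard inequality for s-convex
   functions, and the factor involving |x - k|^p is computed exactly, the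
   position of k with respect to m deciding between eps1 and eps2.
   Since f' need not be continuous, the fundamental theorem of calculus is
   needed for everywhere differentiable functions with bounded derivative;
   s-convexity of |f'|^q provides the bound. *)

Require Import Defs.
From HB Require Import structures.
From mathcomp Require Import all_boot all_order all_algebra.
From mathcomp Require Import all_classical all_reals all_analysis.
From mathcomp Require Import measurable_realfun ring lra.
Import Order.TTheory GRing.Theory Num.Theory.
Import numFieldNormedType.Exports.
Local Open Scope classical_set_scope.
Local Open Scope ring_scope.

(** * The fundamental theorem of calculus for bounded derivatives *)

(** Dominated convergence works with sequences, so the derivative is read along the positive steps
    [harmonic n], that is 1/(n + 1). *)
Lemma cvg_derive1_harmonic (R : realType) (f : R -> R) (x : R) :
  derivable f x 1 ->
  (harmonic n)^-1 * (f (x + harmonic n) - f x) @[n --> \oo] --> f^`()%classic x.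
Proof.
move=> dfx; rewrite derive1E.
have /cvgr_dnbhsP/(_ (@harmonic R)) := dfx.
rewrite (_ : (fun n => (harmonic n)^-1 * (f (x + harmonic n) - f x)) =
  (fun n => (harmonic n)^-1 *: (f (harmonic n *: 1 + x) - f x))); last first.
  by apply/funext => n; rewrite [harmonic n *: 1]mulr1 (addrC _ x).
apply; split; last exact: cvg_harmonic.
by move=> n; rewrite gt_eqF// harmonic_gt0.
Qed.

(** [Num.max a (Num.min x b)] is the projection of [x] onto [[a, b]]; composing with it extends a
    function by constants and keeps its Lipschitz constant. *)
Lemma clamp_lipschitz (R : realType) (a b x y : R) : a <= b ->
  `|Num.max a (Num.min x b) - Num.max a (Num.min y b)| <= `|x - y|.
Proof.
move=> ab; wlog xy : x y / x <= y.
  move=> H; have [/H//|/ltW/H] := leP x y.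
  by rewrite distrC (distrC y).
rewrite !(distrC _ y) !(distrC _ (Num.max _ (Num.min y b))).
rewrite !ger0_norm ?subr_ge0//; last by rewrite ge_max !le_max lexx/= le_min !ge_min xy lexx !orbT.
case: (leP y b) => yb; case: (leP a y) => ay; case: (leP x b) => xb;
case: (leP a x) => ax; case: (leP a b) ab => ?; lra.
Qed.

Lemma bounded_derive_lipschitz (R : realType) (h : R -> R) (a b M : R) :
  {in `[a, b], forall x, derivable h x 1} ->
  {in `[a, b], forall x, `|h^`()%classic x| <= M} ->
  {in `[a, b] &, forall x y, `|h x - h y| <= M * `|x - y|}.
Proof.
move=> dh hM.
suff H x y : x \in `[a, b] -> y \in `[a, b] -> x <= y ->
    `|h x - h y| <= M * `|x - y|.
  move=> x y xab yab; have [/H|/ltW/H] := leP x y; first exact.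
  by rewrite distrC (distrC x); exact.
move=> xab yab xy.
have sub : {subset `[x, y] <= `[a, b]}.
  move=> z; move: xab yab; rewrite !in_itv/= => /andP[ax _] /andP[_ yb] /andP[xz zy].
  by rewrite (le_trans ax)//= (le_trans zy).
have [] := @MVT_segment R h h^`()%classic x y xy.
- move=> z zxy; rewrite derive1E; apply/derivableP/dh/sub.
  exact: subset_itv_oo_cc zxy.
- by apply: derivable_within_continuous => z /sub/dh.
- by move=> z /sub/hM zM; rewrite (distrC (h x)) => ->; rewrite normrM (distrC x) ler_wpM2r.
Qed.

Lemma derivable_is_derive (R : realType) (f : R -> R) (x l : R) :
  derivable f x 1 -> f^`()%classic x = l -> is_derive x 1 f l.
Proof. by move=> dfx <-; rewrite derive1E; exact/derivableP. Qed.

(* Dominated convergence applied to the difference quotients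
   [n * (H (x + 1/n) - H x)], where [H] extends [h] by constants outside
   [[a, b]]; their integrals are computed by the continuous FTC. *)
Lemma bounded_derive_FTC2 (R : realType) (h : R -> R) (a b M : R) : a < b ->
  {in `[a, b], forall x, derivable h x 1} ->
  {in `[a, b], forall x, `|h^`()%classic x| <= M} ->
  measurable_fun `[a, b] h^`()%classic ->
  Rintegral lebesgue_measure `[a, b] h^`()%classic = h b - h a.
Proof.
move=> ab dh hM mh'.
have M0 : 0 <= M by rewrite (le_trans _ (hM a _))// in_itv/= lexx ltW.
pose H x := h (Num.max a (Num.min x b)).
have clab x : Num.max a (Num.min x b) \in `[a, b].
  by rewrite in_itv/= le_max lexx/= ge_max (ltW ab) ge_min lexx orbT.
have Hh x : x \in `[a, b] -> H x = h x.
  by rewrite in_itv/= => /andP[ax xb]; rewrite /H (min_idPl xb) (max_idPr ax).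
have HM x y : `|H x - H y| <= M * `|x - y|.
  rewrite (le_trans (bounded_derive_lipschitz _ _ _ _ _ dh hM _ _ _ _))//.
  by rewrite ler_wpM2l// clamp_lipschitz// ltW.
have cH : continuous H.
  move=> x; apply/cvgrPdist_le => /= e e0.
  have [MN|M1] := eqVneq M 0.
    by near=> y; rewrite (le_trans (HM _ _))// MN mul0r ltW.
  have Mgt0 : 0 < M by rewrite lt0r M1.
  near=> y; rewrite (le_trans (HM _ _))// -ler_pdivlMl// mulrC.
  near: y; apply: cvgr_dist_le; first exact: cvg_id.
  by rewrite divr_gt0.
have intH c d : lebesgue_measure.-integrable `[c, d] (EFin \o H).
  apply: continuous_compact_integrable; first exact: segment_compact.
  exact: continuous_subspaceT.
(* Starting the primitive at [a - 1] makes [a] an interior point, so [G] has a two-sided derivative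
   there too. *)
have [G GH] : exists G : R -> R, forall x, a - 1 < x -> is_derive x 1 G (H x).
  exists (fun x => Rintegral lebesgue_measure `[a - 1, x] H) => x ax.
  have [|dG G'] := @continuous_FTC1_closed R H (a - 1) x (x + 1) _ (intH _ _) ax (cH x).
    by rewrite ltrDl.
  exact: derivable_is_derive.
pose D (F : R -> R) n x := (harmonic n)^-1 * (F (x + harmonic n) - F x).
have hn0 n : 0 < harmonic n :> R by exact: harmonic_gt0.
have shift_derive n x : a - 1 < x -> is_derive x 1 (D G n) (D H n x).
  move=> ax.
  have i1 := GH x ax.
  have i2 : is_derive (x + harmonic n) 1 G (H (x + harmonic n)).
    by apply: GH; rewrite ltr_wpDr// ltW.
  have i3 : is_derive x 1 (fun y : R => y + harmonic n) 1.
    by rewrite -[X in is_derive _ _ _ X]addr0; exact: is_deriveD.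
  have i4 := @is_derive1_comp R G (fun y => y + harmonic n) x (H (x + harmonic n)) 1 i2 i3.
  apply: (is_derive_eq (is_deriveZ (harmonic n)^-1 (is_deriveB i4 i1))).
  by rewrite mulr1.
have cDH n : continuous (D H n).
  move=> x; apply: cvgM; first exact: cvg_cst.
  apply: cvgB; last exact: cH.
  have : {for x, continuous (H \o (fun y => y + harmonic n))}.
    apply: continuous_comp; last exact: cH.
    by apply: cvgD; [exact: cvg_id|exact: cvg_cst].
  exact.
have intD n : (\int[lebesgue_measure]_(x in `[a, b]) (D H n x)%:E =
    (D G n b)%:E - (D G n a)%:E)%E.
  have a1 x : a <= x -> a - 1 < x by move=> ?; lra.
  have cDG x : a <= x -> {for x, continuous (D G n)}.
    move=> /a1 /(shift_derive n) [dG _].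
    by apply: differentiable_continuous; exact/derivable1_diffP.
  apply: (@continuous_FTC2 R (D H n) (D G n) a b ab).
  - by apply: continuous_subspaceT => x; exact: cDH.
  - split.
    + by move=> x /[!in_itv]/= /andP[/ltW/a1/(shift_derive n)[]].
    + by apply: cvg_at_right_filter; exact: cDG.
    + by apply: cvg_at_left_filter; apply: cDG; exact: ltW.
  - move=> x /[!in_itv]/= /andP[/ltW/a1/(shift_derive n) dG _].
    by rewrite derive1E; exact: derive_val.
(* Used at [a] and [b]: the integrals of [D H n] tend to [H b - H a], which is [h b - h a]. *)
have limG x : a <= x -> D G n x @[n --> \oo] --> H x.
  move=> ax; have dG : is_derive x 1 G (H x) by apply: GH; lra.
  have <- : G^`()%classic x = H x by rewrite derive1E; exact: derive_val.
  by apply: cvg_derive1_harmonic; exact: ex_derive.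
(* At [b] the forward quotients of [H] are 0, whatever the derivative of [h]. Hence the open
   interval, over which the integrals are the same. *)
have limH x : x \in `]a, b[ -> D H n x @[n --> \oo] --> h^`()%classic x.
  move=> xab; have xab' := subset_itv_oo_cc xab.
  have Hhx : {near x, H =1 h}.
    near=> y; apply: Hh; apply: subset_itv_oo_cc.
    by near: y; exact: near_in_itvoo.
  have <- : H^`()%classic x = h^`()%classic x.
    by rewrite !derive1E; apply: near_eq_derive => //.
  apply: cvg_derive1_harmonic.
  apply: (@near_eq_derivable _ _ _ h H _ _ _ (dh _ xab')).
  by apply: filterS Hhx => y ->.
have [//|||||_ _ dct] := @dominated_convergence _ _ _ (@lebesgue_measure R) `]a, b[
  (measurable_itv _) (fun n x => (D H n x)%:E) (EFin \o h^`()%classic) (cst M%:E).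
- move=> n; apply/measurable_EFinP; apply: measurable_funTS.
  exact: continuous_measurable_fun.
- by apply/measurable_EFinP; apply: measurable_funS mh' => //; exact: subset_itv_oo_cc.
- by apply/aeW => x /limH cx; apply: cvg_EFin => //; exact: nearW.
- have : lebesgue_measure.-integrable `[a, b] (EFin \o cst M).
    apply: continuous_compact_integrable; first exact: segment_compact.
    by apply: continuous_subspaceT => x; exact: cvg_cst.
  by apply: integrableS => //; exact: subset_itv_oo_cc.
(* The Lipschitz bound cancels the step and leaves the constant [M] as dominating function. *)
- apply/aeW => x n _; rewrite lee_fin normrM normfV.
  by rewrite ler_pdivrMl ?normr_gt0 ?gt_eqF// mulrC (le_trans (HM _ _))// addrC addKr.
rewrite /Rintegral integral_itv_bndoo; last first.
  by apply/measurable_EFinP; apply: measurable_funS mh' => //; exact: subset_itv_oo_cc.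
have E n : (\int[lebesgue_measure]_(x in `]a, b[) (D H n x)%:E =
    (D G n b - D G n a)%:E)%E.
  rewrite EFinB -intD [RHS]integral_itv_bndoo//.
  apply/measurable_EFinP; apply: measurable_funTS.
  exact: continuous_measurable_fun.
have : (D G n b - D G n a)%:E @[n --> \oo] --> (h b - h a)%:E.
  apply: cvg_EFin; first exact: nearW.
  rewrite -(Hh b) ?in_itv/= ?lexx ?ltW// -(Hh a) ?in_itv/= ?lexx ?ltW//.
  by apply: cvgB; apply: limG => //; exact: ltW.
under eq_fun do rewrite -E.
by move=> limI; rewrite (cvg_unique (@ereal_hausdorff R) dct limI).
Unshelve. all: by end_near. Qed.

(** * Integrals of |x - k|^p *)

(** Away from [k] the power is differentiable, its base being positive. At [k] the base is 0 and
    continuity is checked directly, with radius e^(1/p). *)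
Lemma continuous_normr_powR (R : realType) (k p : R) : 0 < p ->
  continuous (fun x : R => `|x - k| `^ p).
Proof.
move=> p0 x; have cnk : (fun y : R => `|y - k|) y @[y --> x] --> `|x - k|.
  by apply: cvg_norm; apply: cvgB; [exact: cvg_id|exact: cvg_cst].
have [xk|xk] := eqVneq (x - k) 0.
  apply/cvgrPdist_le => /= e e0; near=> y.
  rewrite xk normr0 powR0 ?gt_eqF// sub0r normrN ger0_norm ?powR_ge0//.
  have -> : e = (e `^ p^-1) `^ p by rewrite -powRrM mulVf ?gt_eqF// powRr1// ltW.
  apply: ge0_ler_powR; [exact: ltW|by rewrite nnegrE|by rewrite nnegrE powR_ge0|apply: ltW].
  near: y; move/cvgrPdist_lt : cnk => /(_ (e `^ p^-1) (powR_gt0 _ e0)).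
  by apply: filterS => y; rewrite xk normr0 sub0r normrN normr_id.
have : {for x, continuous ((fun y => y `^ p) \o (fun y : R => `|y - k|))}.
  apply: continuous_comp => //.
  apply: differentiable_continuous; apply/derivable1_diffP.
  by apply: derivable_powR; rewrite in_itv/= andbT normr_gt0.
exact.
Unshelve. all: by end_near. Qed.

Lemma integrable_itv_continuous (R : realType) (f : R -> R) (c d : R) :
  continuous f -> lebesgue_measure.-integrable `[c, d] (EFin \o f).
Proof.
move=> cf; apply: continuous_compact_integrable; first exact: segment_compact.
exact: continuous_subspaceT.
Qed.

(* [e] is the sign of [x - k]. *)
Lemma is_derive_signed_powR (R : realType) (k p e x : R) :
  0 < p -> e \in [:: 1; -1] -> 0 < e * (x - k) ->
  is_derive x 1 (fun y => e * (p + 1)^-1 * `|y - k| `^ (p + 1)) (`|x - k| `^ p).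
Proof.
move=> p0 e1 xk.
have ee : e * e = 1 by move: e1; rewrite !inE => /orP[]/eqP ->; ring.
have E y : 0 < e * (y - k) -> `|y - k| = e * (y - k).
  move: e1; rewrite !inE => /orP[]/eqP ->; rewrite ?mul1r ?mulN1r ?oppr_gt0 => h.
    by rewrite gtr0_norm.
  by rewrite ltr0_norm.
have i1 : is_derive x 1 (fun y => e * (y - k)) e.
  apply: (is_derive_eq (is_deriveZ e (is_deriveB (is_derive_id x 1) (is_derive_cst k x 1)))).
  by rewrite subr0 [LHS]mulr1.
have i2 := @is_derive1_powR R (p + 1) (e * (x - k)) xk.
have i3 := @is_derive1_comp R (fun y => y `^ (p + 1)) (fun y => e * (y - k)) x _ _ i2 i1.
have i4 := is_deriveZ (e * (p + 1)^-1) i3.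
have i5 : is_derive x 1 (fun y => e * (p + 1)^-1 * (e * (y - k)) `^ (p + 1))
    (`|x - k| `^ p).
  apply: (is_derive_eq i4); rewrite E// addrK.
  have -> : (e / (p + 1)) *: ((p + 1) * (e * (x - k)) `^ p * e) =
    (e * e) * ((p + 1) / (p + 1)) * (e * (x - k)) `^ p.
    by rewrite /GRing.scale/=; ring.
  by rewrite ee divff ?mul1r// gt_eqF// addr_gt0.
(* The formula e (y - k) for |y - k| holds only on the side of [k] that contains [x], hence near
   [x]. *)
apply: near_eq_is_derive i5.
have /cvgr_gt/(_ _ xk) : (fun y => e * (y - k)) y @[y --> x] --> e * (x - k).
  apply: cvgM; first exact: cvg_cst.
  by apply: cvgB; [exact: cvg_id|exact: cvg_cst].
by apply: filterS => y /E ->.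
Qed.


(** The sign is prescribed on the open interval only: the antiderivative is continuous everywhere,
    so [k] may be an endpoint. *)
Lemma Rintegral_signed_powR (R : realType) (k p e c d : R) :
  0 < p -> e \in [:: 1; -1] -> c <= d ->
  {in `]c, d[, forall x, 0 < e * (x - k)} ->
  Rintegral lebesgue_measure `[c, d] (fun x => `|x - k| `^ p) =
  e * (p + 1)^-1 * (`|d - k| `^ (p + 1) - `|c - k| `^ (p + 1)).
Proof.
move=> p0 e1; rewrite le_eqVlt => /predU1P[<- _|cd ek].
  by rewrite set_itv1 Rintegral_set1 subrr mulr0.
pose F y := e * (p + 1)^-1 * `|y - k| `^ (p + 1).
have cF : continuous F.
  move=> x; apply: cvgM; first exact: cvg_cst.
  by apply: continuous_normr_powR; rewrite addr_gt0.
have dF x : x \in `]c, d[ -> is_derive x 1 F (`|x - k| `^ p).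
  by move=> /ek; exact: is_derive_signed_powR.
rewrite /Rintegral (@continuous_FTC2 R (fun x => `|x - k| `^ p) F c d cd).
- by rewrite /= /F mulrBr.
- by apply: continuous_subspaceT; exact: continuous_normr_powR.
- split.
  + by move=> x /dF[].
  + by apply: cvg_at_right_filter; exact: cF.
  + by apply: cvg_at_left_filter; exact: cF.
- by move=> x /dF h; rewrite derive1E; exact: derive_val.
Qed.

Lemma Rintegral_itv_split (R : realType) (f : R -> R) (c k d : R) :
  c <= k <= d -> lebesgue_measure.-integrable `[c, d] (EFin \o f) ->
  Rintegral lebesgue_measure `[c, d] f =
  Rintegral lebesgue_measure `[c, k] f + Rintegral lebesgue_measure `[k, d] f.
Proof.
move=> /andP[ck kd] intf.
rewrite -(@Rintegral_itv_obnd_cbnd R k (BRight d)); last first.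
  by apply: integrableS intf => //; apply: subset_itvr; rewrite bnd_simp.
by rewrite -(@Rintegral_itvB R f (BLeft c) (BRight d) k)// ?bnd_simp// subrKC.
Qed.

(** The sign is -1 throughout; this difference of powers becomes [eps2] on [[a, m]]. *)
Lemma Rintegral_powR_out (R : realType) (k p c d : R) :
  0 < p -> c <= d -> d <= k ->
  Rintegral lebesgue_measure `[c, d] (fun x => `|x - k| `^ p) =
  (p + 1)^-1 * ((k - c) `^ (p + 1) - (k - d) `^ (p + 1)).
Proof.
move=> p0 cd dk; rewrite (@Rintegral_signed_powR R k p (-1))//; last 2 first.
- by rewrite !inE eqxx orbT.
- by move=> x /[!in_itv]/= /andP[_ xd]; rewrite mulN1r oppr_gt0 subr_lt0 (lt_le_trans xd).
rewrite !(distrC _ k) !ger0_norm ?subr_ge0//; [by ring|exact: le_trans dk].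
Qed.

(** Cutting at [k] leaves two one-sided integrals whose powers add: the source of [eps1]. *)
Lemma Rintegral_powR_in (R : realType) (k p c d : R) :
  0 < p -> c <= k -> k <= d ->
  Rintegral lebesgue_measure `[c, d] (fun x => `|x - k| `^ p) =
  (p + 1)^-1 * ((k - c) `^ (p + 1) + (d - k) `^ (p + 1)).
Proof.
move=> p0 ck kd; rewrite (@Rintegral_itv_split _ _ _ k) ?ck//; last first.
  by apply: integrable_itv_continuous; exact: continuous_normr_powR.
rewrite Rintegral_powR_out// subrr powR0 ?subr0 ?gt_eqF ?addr_gt0//.
rewrite (@Rintegral_signed_powR R k p 1)//; last 2 first.
- by rewrite !inE eqxx.
- by move=> x /[!in_itv]/= /andP[kx _]; rewrite mul1r subr_gt0.
rewrite subrr normr0 powR0 ?gt_eqF ?addr_gt0// ger0_norm ?subr_ge0//.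
by ring.
Qed.

(** The mirror case, which becomes [eps2] on [[m, b]]. *)
Lemma Rintegral_powR_left (R : realType) (k p c d : R) :
  0 < p -> k <= c -> c <= d ->
  Rintegral lebesgue_measure `[c, d] (fun x => `|x - k| `^ p) =
  (p + 1)^-1 * ((d - k) `^ (p + 1) - (c - k) `^ (p + 1)).
Proof.
move=> p0 kc cd; rewrite (@Rintegral_signed_powR R k p 1)//; last 2 first.
- by rewrite !inE eqxx.
- by move=> x /[!in_itv]/= /andP[cx _]; rewrite mul1r subr_gt0 (le_lt_trans kc).
rewrite mul1r !ger0_norm ?subr_ge0//; exact: le_trans cd.
Qed.

(** * Hoelder's inequality for real-valued integrals *)

(** Extending [u] and [v] by zero outside [D] turns integrals over [D] into norms on the whole
    space, where [hoelder] applies. *)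
Lemma Rintegral_hoelder (d : measure_display) (T : measurableType d) (R : realType)
    (mu : {measure set T -> \bar R}) (D : set T) (u v : T -> R) (p q : R) :
  measurable D -> measurable_fun D u -> measurable_fun D v ->
  0 < p -> 0 < q -> p^-1 + q^-1 = 1 ->
  mu.-integrable D (EFin \o (fun x => `|u x| `^ p)) ->
  mu.-integrable D (EFin \o (fun x => `|v x| `^ q)) ->
  Rintegral mu D (fun x => `|u x * v x|) <=
  Rintegral mu D (fun x => `|u x| `^ p) `^ p^-1 *
  Rintegral mu D (fun x => `|v x| `^ q) `^ q^-1.
Proof.
move=> mD mu_ mv p0 q0 pq ip iq.
have LnormE w r : 0 < r -> mu.-integrable D (EFin \o (fun x => `|w x| `^ r)) ->
    Lnorm mu r%:E (EFin \o (w \_ D)) =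
    (Rintegral mu D (fun x => `|w x| `^ r) `^ r^-1)%:E.
  move=> r0 ir.
  have E : (\int[mu]_x (`|(EFin \o (w \_ D)) x| `^ r) =
      (Rintegral mu D (fun x => `|w x| `^ r))%:E)%E.
    rewrite /Rintegral fineK; last exact: integrable_fin_num.
    rewrite [RHS]integral_mkcond; apply: eq_integral => x _ /=.
    by rewrite !patchE; case: ifPn => _ //=; rewrite normr0 powR0// gt_eqF.
  by rewrite unlock E.
have := @hoelder _ _ _ mu (u \_ D) (v \_ D) p q _ _ p0 q0 pq.
rewrite !LnormE// Lnorm1 -EFinM.
have -> : (\int[mu]_x `|(EFin \o ((u \_ D) \* (v \_ D))%R) x| =
    \int[mu]_(x in D) `|u x * v x|%:E)%E.
  rewrite [RHS]integral_mkcond; apply: eq_integral => x _ /=.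
  by rewrite !patchE; case: ifPn => _ //=; rewrite mul0r normr0.
have mr (w : T -> R) : measurable_fun D w -> measurable_fun [set: T] (w \_ D).
  by move=> mw; apply/(measurable_restrictT _ mD).
move=> /(_ (mr _ mu_) (mr _ mv)).
(* The finite right-hand side forces [I] to be finite, so that [fineK] brings the inequality down to
   the reals. *)
set I := (I in (I <= _)%E) => IB; have Ifin : I \is a fin_num.
  rewrite ge0_fin_numE ?(le_lt_trans IB) ?ltry//.
  by apply: integral_ge0 => x _; rewrite lee_fin.
by rewrite -lee_fin fineK.
Qed.


(** * Bounds for s-convex functions *)

Lemma sconvex_onS (R : realType) (s : R) (g : R -> R) (a b c d : R) :
  a <= c -> d <= b -> sconvex_on s g a b -> sconvex_on s g c d.
Proof.
move=> ac db [g0 gs]; have sub x : x \in `[c, d] -> x \in `[a, b].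
  by rewrite !in_itv/= => /andP[cx xd]; rewrite (le_trans ac)//= (le_trans xd).
by split=> [x /sub/g0|x y t /sub xab /sub yab]//; exact: gs.
Qed.

(** [x] is the combination of [a] and [b] with weights (b - x)/(b - a) and (x - a)/(b - a). The
    absolute values make the bound continuous on the whole line and match the integrals of |x -
    k|^s. *)
Lemma sconvex_itv_le (R : realType) (s : R) (g : R -> R) (a b x : R) :
  sconvex_on s g a b -> a < b -> x \in `[a, b] ->
  g x <= (b - a)^-1 `^ s * (`|x - b| `^ s * g a + `|x - a| `^ s * g b).
Proof.
move=> [_ gs] ab; rewrite in_itv/= => /andP[ax xb].
have ba0 : 0 < b - a by rewrite subr_gt0.
have := gs a b ((b - x) / (b - a)).
rewrite !in_itv/= !lexx (ltW ab) => /(_ isT isT).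
rewrite divr_ge0 ?subr_ge0 ?(ltW ab)// ler_pdivrMr// mul1r lerD2l lerN2 => /(_ isT ax).
have -> : 1 - (b - x) / (b - a) = (x - a) / (b - a) by field; rewrite gt_eqF.
have -> : (b - x) / (b - a) * a + (x - a) / (b - a) * b = x.
  by field; rewrite gt_eqF.
move=> /le_trans; apply; rewrite !powRM ?subr_ge0// ?invr_ge0 ?(ltW ba0)//.
rewrite (distrC x b) !ger0_norm ?subr_ge0//.
by rewrite le_eqVlt; apply/orP; left; apply/eqP; ring.
Qed.

(** Both weights are at most 1, and so are their powers because [s] is positive. *)
Lemma sconvex_bounded (R : realType) (s : R) (g : R -> R) (a b x : R) :
  0 < s -> sconvex_on s g a b -> a < b -> x \in `[a, b] -> g x <= g a + g b.
Proof.
move=> s0 gs ab xab; rewrite (le_trans (sconvex_itv_le _ _ _ _ _ _ gs ab xab))//.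
move: xab; rewrite in_itv/= => /andP[ax xb].
have ba0 : 0 < b - a by rewrite subr_gt0.
have [ga gb] : 0 <= g a /\ 0 <= g b.
  by split; apply: gs.1; rewrite in_itv/= lexx ltW.
have le1 y : 0 <= y <= b - a -> (b - a)^-1 `^ s * y `^ s <= 1.
  move=> /andP[y0 yba]; rewrite -powRM ?invr_ge0 ?(ltW ba0)// mulrC [leRHS](_ : 1 = 1 `^ s); last by rewrite powR1.
  apply: ge0_ler_powR; rewrite ?nnegrE ?(ltW s0)// ?divr_ge0 ?(ltW ba0)//.
  by rewrite ler_pdivrMr// mul1r.
rewrite mulrDr !mulrA lerD// ler_piMl// le1// normr_ge0/=.
  by rewrite distrC ger0_norm ?subr_ge0// lerD2l lerN2.
by rewrite ger0_norm ?subr_ge0// lerD2r.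
Qed.

(** Integration of the pointwise bound: each weight contributes (b - a)^(s+1)/(s + 1), and the
    prefactor (b - a)^(-s) reduces this to (b - a)/(s + 1). *)
Lemma sconvex_hermite_hadamard_le (R : realType) (s : R) (g : R -> R) (a b : R) :
  0 < s -> sconvex_on s g a b -> a < b ->
  lebesgue_measure.-integrable `[a, b] (EFin \o g) ->
  Rintegral lebesgue_measure `[a, b] g <= (b - a) * (s + 1)^-1 * (g a + g b).
Proof.
move=> s0 gs ab ig; have ba0 : 0 < b - a by rewrite subr_gt0.
pose J (k x : R) : R := `|x - k| `^ s.
have cJ k : continuous (J k) by exact: continuous_normr_powR.
have iJ k r : lebesgue_measure.-integrable `[a, b] (EFin \o (fun x => J k x * r)).
  by apply: integrable_itv_continuous => x; apply: cvgM; [exact: cJ|exact: cvg_cst].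
pose S x := J b x * g a + J a x * g b.
have iS : lebesgue_measure.-integrable `[a, b] (EFin \o S).
  apply: integrable_itv_continuous => x.
  by apply: cvgD; apply: cvgM; [exact: cJ|exact: cvg_cst|exact: cJ|exact: cvg_cst].
have iC : lebesgue_measure.-integrable `[a, b]
    (EFin \o (fun x => (b - a)^-1 `^ s * S x)).
  apply: integrable_itv_continuous => x; apply: cvgM; first exact: cvg_cst.
  by apply: cvgD; apply: cvgM; [exact: cJ|exact: cvg_cst|exact: cJ|exact: cvg_cst].
apply: (@le_trans _ _ (Rintegral lebesgue_measure `[a, b]
    (fun x => (b - a)^-1 `^ s * S x))).
  by apply: le_Rintegral => // x xab; exact: sconvex_itv_le.
rewrite RintegralZl// RintegralD// !RintegralZr//; last 2 first.
- by apply: integrable_itv_continuous; exact: cJ.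
- by apply: integrable_itv_continuous; exact: cJ.
have ab' := ltW ab.
rewrite /J (@Rintegral_powR_out R b)// (@Rintegral_powR_left R a)// !subrr.
rewrite powR0 ?gt_eqF ?addr_gt0// !subr0.
have E : (b - a)^-1 `^ s * (b - a) `^ (s + 1) = b - a.
  rewrite (@powRD _ (b - a) s 1); last by rewrite (gt_eqF ba0) implybT.
  rewrite mulrA -powRM ?invr_ge0 ?(ltW ba0)// mulVf ?(gt_eqF ba0)//.
  by rewrite powR1 mul1r powRr1 ?(ltW ba0).
rewrite -[X in _ <= X * _ * _]E le_eqVlt; apply/orP; left; apply/eqP; ring.
Qed.

(** * Integration by parts and the estimate on one subinterval *)

Lemma bounded_integrable_itv (R : realType) (w : R -> R) (c d M : R) :
  measurable_fun `[c, d] w -> {in `[c, d], forall x, `|w x| <= M} ->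
  lebesgue_measure.-integrable `[c, d] (EFin \o w).
Proof.
move=> mw wM.
have iM : lebesgue_measure.-integrable `[c, d] (EFin \o cst M).
  by apply: integrable_itv_continuous => x; exact: cvg_cst.
apply: le_integrable iM => //; first exact/measurable_EFinP.
by move=> x xcd; rewrite lee_fin (le_trans (wM _ xcd))// ler_norm.
Qed.

Lemma integrable_itv_derivable (R : realType) (f : R -> R) (c d : R) :
  {in `[c, d], forall x, derivable f x 1} ->
  lebesgue_measure.-integrable `[c, d] (EFin \o f).
Proof.
move=> df; apply: continuous_compact_integrable; first exact: segment_compact.
exact: derivable_within_continuous.
Qed.

(** The fundamental theorem applied to (x - k) f(x). Its derivative is bounded because [f], being
    Lipschitz, is bounded on [[c, d]] as well. *)
Lemma bounded_derive_by_parts (R : realType) (f : R -> R) (c d k B : R) :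
  c < d -> {in `[c, d], forall x, derivable f x 1} ->
  {in `[c, d], forall x, `|f^`()%classic x| <= B} ->
  measurable_fun `[c, d] f^`()%classic ->
  (d - k) * f d - (c - k) * f c - Rintegral lebesgue_measure `[c, d] f =
  Rintegral lebesgue_measure `[c, d] (fun x => (x - k) * f^`()%classic x).
Proof.
move=> cd df fB mf'.
have B0 : 0 <= B by rewrite (le_trans _ (fB c _))// in_itv/= lexx ltW.
have ccd : c \in `[c, d] by rewrite in_itv/= lexx ltW.
have dist x : x \in `[c, d] -> `|x - c| <= d - c.
  by rewrite in_itv/= => /andP[cx xd]; rewrite ger0_norm ?subr_ge0// lerD2r.
have kM x : x \in `[c, d] -> `|x - k| <= (d - c) + `|c - k|.
  move=> xcd; have -> : x - k = (x - c) + (c - k) by ring.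
  by rewrite (le_trans (ler_normD _ _))// lerD2r dist.
have fM x : x \in `[c, d] -> `|f x| <= B * (d - c) + `|f c|.
  move=> xcd; have -> : f x = (f x - f c) + f c by ring.
  rewrite (le_trans (ler_normD _ _))// lerD2r.
  rewrite (le_trans (bounded_derive_lipschitz _ _ _ _ _ df fB _ _ xcd ccd))//.
  by rewrite ler_wpM2l// dist.
pose h x := (x - k) * f x.
have dh x : x \in `[c, d] -> is_derive x 1 h (f x + (x - k) * f^`()%classic x).
  move=> xcd.
  have i1 := is_deriveB (is_derive_id x 1) (is_derive_cst k x 1).
  have i2 := derivable_is_derive _ _ _ _ (df _ xcd) erefl.
  by apply: (is_derive_eq (is_deriveM i1 i2)); rewrite /GRing.scale/= !fctE; ring.
have h'E x : x \in `[c, d] -> h^`()%classic x = f x + (x - k) * f^`()%classic x.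
  by move=> /dh i; rewrite derive1E; exact: derive_val.
have intf := @integrable_itv_derivable R f c d df.
have mk : measurable_fun `[c, d] (fun x => (x - k) * f^`()%classic x).
  by apply: measurable_funM => //; exact: measurable_funB.
have kf'M x : x \in `[c, d] ->
    `|(x - k) * f^`()%classic x| <= ((d - c) + `|c - k|) * B.
  by move=> xcd; rewrite normrM ler_pM ?kM ?fB.
have intk := bounded_integrable_itv _ _ _ _ _ mk kf'M.
have mh : measurable_fun `[c, d] h^`()%classic.
  apply: (eq_measurable_fun (fun x => f x + (x - k) * f^`()%classic x)).
    by move=> x; rewrite inE => /h'E.
  apply: measurable_funD => //.
  by apply/measurable_EFinP; exact: measurable_int intf.
(* The constant is the sum of the bounds in [fM] and [kf'M], one for each summand of the derivative
   of [h]. *)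
have := @bounded_derive_FTC2 R h c d
  (B * (d - c) + `|f c| + ((d - c) + `|c - k|) * B) cd.
rewrite (@eq_Rintegral _ _ _ lebesgue_measure `[c, d]
  (fun x => f x + (x - k) * f^`()%classic x)); last first.
  by move=> x; rewrite inE => /h'E.
rewrite RintegralD// => FTC.
suff hE : h d - h c = Rintegral lebesgue_measure `[c, d] f +
    Rintegral lebesgue_measure `[c, d] (fun x => (x - k) * f^`()%classic x).
  by rewrite -/(h d) -/(h c) hE addrAC subrr add0r.
apply/esym/FTC => //.
- by move=> x /dh[].
- by move=> x xcd; rewrite h'E// (le_trans (ler_normD _ _))// lerD ?fM ?kf'M.
Qed.

(** Integration by parts, then Hoelder, then Hermite-Hadamard for |f'|^q. Since [k] is arbitrary,
    one statement serves both halves of [[a, b]]. *)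
Lemma sconvex_derive_by_parts_le (R : realType) (f : R -> R) (c d k s p q : R) :
  c <= d -> 0 < s -> 0 < p -> 0 < q -> p^-1 + q^-1 = 1 ->
  {in `[c, d], forall x, derivable f x 1} ->
  measurable_fun `[c, d] f^`()%classic ->
  sconvex_on s (fun x => `|f^`()%classic x| `^ q) c d ->
  `|(d - k) * f d - (c - k) * f c - Rintegral lebesgue_measure `[c, d] f| <=
  Rintegral lebesgue_measure `[c, d] (fun x => `|x - k| `^ p) `^ p^-1 *
  ((d - c) * (s + 1)^-1 *
    (`|f^`()%classic c| `^ q + `|f^`()%classic d| `^ q)) `^ q^-1.
Proof.
move=> + s0 p0 q0 pq df mf' gs.
(* The degenerate case does occur: the dividing point is an endpoint when [al] is 0 or 1. *)
rewrite le_eqVlt => /predU1P[<-|cd].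
  by rewrite set_itv1 Rintegral_set1 subr0 subrr normr0 mulr_ge0 ?powR_ge0.
set g := fun x => _ in gs.
have gM x : x \in `[c, d] -> g x <= g c + g d by exact: sconvex_bounded gs cd.
(* Taking the q-th root of the bound on |f'|^q bounds f' itself, as integration by parts
   requires. *)
have f'M x : x \in `[c, d] -> `|f^`()%classic x| <= (g c + g d) `^ q^-1.
  move=> /gM gx; rewrite -[leLHS](@powRr1 R)// -(@divff _ q) ?gt_eqF//.
  rewrite powRrM ge0_ler_powR ?nnegrE ?powR_ge0 ?invr_ge0 ?(ltW q0)//.
  by rewrite addr_ge0 ?powR_ge0.
rewrite (@bounded_derive_by_parts R f c d k ((g c + g d) `^ q^-1))//.
have mg : measurable_fun `[c, d] g.
  apply: (@measurableT_comp _ _ _ _ _ _ (fun y : R => y `^ q)).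
    exact: measurable_powR.
  exact: measurableT_comp.
have ig : lebesgue_measure.-integrable `[c, d] (EFin \o g).
  apply: (@bounded_integrable_itv _ _ _ _ (g c + g d)) => // x /gM.
  by rewrite ger0_norm ?powR_ge0.
have mk : measurable_fun `[c, d] (fun x => x - k) by exact: measurable_funB.
have ik : lebesgue_measure.-integrable `[c, d] (EFin \o (fun x => `|x - k| `^ p)).
  by apply: integrable_itv_continuous; exact: continuous_normr_powR.
apply: (@le_trans _ _ (Rintegral lebesgue_measure `[c, d]
    (fun x => `|(x - k) * f^`()%classic x|))).
  apply: le_normr_Rintegral => //.
  apply: (@bounded_integrable_itv _ _ _ _
    (((d - c) + `|c - k|) * (g c + g d) `^ q^-1)).
    exact: measurable_funM.
  move=> x xcd; rewrite normrM ler_pM ?f'M//.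
  have -> : x - k = (x - c) + (c - k) by ring.
  rewrite (le_trans (ler_normD _ _))// lerD2r.
  by move: xcd; rewrite in_itv/= => /andP[cx xd]; rewrite ger0_norm ?subr_ge0// lerD2r.
rewrite (le_trans (Rintegral_hoelder _ _ _ _ _ _ _ p q _ _ _ _ _ _ _ _))//.
rewrite ler_wpM2l ?powR_ge0// ge0_ler_powR ?invr_ge0 ?(ltW q0)//.
- by rewrite nnegrE; apply: Rintegral_ge0 => x _; exact: powR_ge0.
- rewrite nnegrE mulr_ge0 ?addr_ge0 ?powR_ge0// mulr_ge0 ?subr_ge0 ?(ltW cd)//.
  by rewrite invr_ge0 addr_ge0// ltW.
- exact: sconvex_hermite_hadamard_le.
Qed.

(** * Assembly of the two halves and the three cases *)

(** Strictly between [a] and [b], the open interval []a, b[] is a neighbourhood of [x] contained in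
    [I]. *)
Lemma interior_itv_convex (R : realType) (I : interval R) (a b x : R) :
  interior [set` I] a -> interior [set` I] b -> x \in `[a, b] ->
  interior [set` I] x.
Proof.
move=> Ia Ib; rewrite in_itv/= le_eqVlt => /andP[/predU1P[<-//|ax]].
rewrite le_eqVlt => /predU1P[->//|xb].
have xab : x \in `]a, b[ by rewrite in_itv/= ax.
apply: filterS (near_in_itvoo xab) => y; rewrite in_itv/= => /andP[ay yb].
apply: (@interval_is_interval _ I a b); try exact: nbhs_singleton.
by rewrite (ltW ay) (ltW yb).
Qed.

(** As (p + 1)/p = 1 + 1/p, the powers of [L] combine with L^(1/q) into L^2. The outer factor [L]
    will cancel the 1/(b - a) in [If]. *)
Lemma powR_scale_bound (R : realType) (L p q s E C : R) :
  0 < L -> 0 < p -> 0 < q -> p^-1 + q^-1 = 1 -> 0 < s -> 0 <= E -> 0 <= C ->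
  ((p + 1)^-1 * (L `^ (p + 1) * E)) `^ p^-1 * (L * (s + 1)^-1 * C) `^ q^-1 =
  L * (L * (p + 1)^-1 `^ p^-1 * (s + 1)^-1 `^ q^-1 * (E `^ p^-1 * C `^ q^-1)).
Proof.
move=> L0 p0 q0 pq s0 E0 C0.
have p1 : 0 <= (p + 1)^-1 by rewrite invr_ge0 addr_ge0// ltW.
have s1 : 0 <= (s + 1)^-1 by rewrite invr_ge0 addr_ge0// ltW.
have L0' := ltW L0.
rewrite !powRM ?mulr_ge0 ?powR_ge0// -powRrM.
have -> : (p + 1) / p = 1 + p^-1 by rewrite mulrDl divff ?gt_eqF// mul1r.
rewrite powRD ?(gt_eqF L0) ?implybT// powRr1//.
have LL : L `^ p^-1 * L `^ q^-1 = L.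
  by rewrite -powRD ?(gt_eqF L0) ?implybT// pq powRr1.
rewrite -[X in _ = L * (X * _ * _ * _)]LL; ring.
Qed.

(* With [m := al * a + (1 - al) * b], integrating [(x - k) * f' x] by parts on
   [[a, m]] with [k := a + al * la * (b - a)] and on [[m, b]] with
   [k := b - (1 - al) * la * (b - a)] produces exactly [(b - a) * If f]. *)
Lemma If_le (R : realType) (f : R -> R) (a b al la s q p : R) :
  a < b -> 0 <= al -> al <= 1 -> 0 < s -> 0 < p -> 0 < q -> p^-1 + q^-1 = 1 ->
  {in `[a, b], forall x, derivable f x 1} ->
  measurable_fun `[a, b] f^`()%classic ->
  sconvex_on s (fun x => `|f^`()%classic x| `^ q) a b ->
  let L := b - a in let m := al * a + (1 - al) * b in
  forall E1 E2,
  Rintegral lebesgue_measure `[a, m] (fun x => `|x - (a + al * la * L)| `^ p) =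
    (p + 1)^-1 * (L `^ (p + 1) * E1) ->
  Rintegral lebesgue_measure `[m, b] (fun x => `|x - (b - (1 - al) * la * L)| `^ p) =
    (p + 1)^-1 * (L `^ (p + 1) * E2) ->
  0 <= E1 -> 0 <= E2 ->
  `|If f la al a b| <= L * (p + 1)^-1 `^ p^-1 * (s + 1)^-1 `^ q^-1 *
    (E1 `^ p^-1 * Cf f al q a b `^ q^-1 + E2 `^ p^-1 * Df f al q a b `^ q^-1).
Proof.
move=> ab al0 al1 s0 p0 q0 pq df mf' gs L m E1 E2 hE1 hE2 E10 E20.
have L0 : 0 < L by rewrite subr_gt0.
have mE : m = a + (1 - al) * L by rewrite /m /L; ring.
have mE' : m = b - al * L by rewrite /m /L; ring.
have am : a <= m by rewrite mE lerDl mulr_ge0 ?subr_ge0// ltW.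
have mb : m <= b by rewrite mE' gerBl mulr_ge0// ltW.
have sub1 : `[a, m] `<=` `[a, b] by apply: subset_itvl; rewrite bnd_simp.
have sub2 : `[m, b] `<=` `[a, b] by apply: subset_itvr; rewrite bnd_simp.
have H1 := @sconvex_derive_by_parts_le R f a m (a + al * la * L) s p q am s0 p0 q0 pq
  (fun x h => df x (sub1 x h)) (measurable_funS _ sub1 mf') (sconvex_onS _ _ _ _ _ _ _ _ mb gs).
have H2 := @sconvex_derive_by_parts_le R f m b (b - (1 - al) * la * L) s p q mb s0 p0 q0 pq
  (fun x h => df x (sub2 x h)) (measurable_funS _ sub2 mf') (sconvex_onS _ _ _ _ _ _ _ am _ gs).
set I1 := (X in `|X| <= _) in H1; set I2 := (X in `|X| <= _) in H2.
(* The coefficient of [f m] is the difference of the two values of k, (1 - la) L; those of [f a] and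
   [f b] are al la L and (1 - al) la L. *)
have IfE : If f la al a b = L^-1 * (I1 + I2).
  rewrite /If (@Rintegral_itv_split R f a m b) ?am//; last exact: integrable_itv_derivable.
  rewrite /I1 /I2 -/m.
  set Ja := (X in _ - _ * (X + _)); set Jb := (X in _ - _ * (_ + X)); set fm := f m.
  rewrite [X in _ = _ * (_ - X + _)](_ : _ = Ja)// [X in _ = _ * (_ + (_ - X))](_ : _ = Jb)//.
  clearbody Ja Jb fm.
  by rewrite /m /L; field; rewrite subr_eq0 gt_eqF.
have Cf0 : 0 <= Cf f al q a b.
  by rewrite /Cf mulr_ge0 ?subr_ge0// addr_ge0 ?powR_ge0.
have Df0 : 0 <= Df f al q a b.
  by rewrite /Df mulr_ge0// addr_ge0 ?powR_ge0.
have mC : (1 - al) * b + al * a = m by rewrite /m addrC.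
(* The length (1 - al) L of [[a, m]] supplies the factor 1 - al of [Cf]; likewise al L supplies the
   factor of [Df]. *)
have CE : (m - a) * (s + 1)^-1 *
    (`|f^`()%classic a| `^ q + `|f^`()%classic m| `^ q) =
    L * (s + 1)^-1 * Cf f al q a b.
  have -> : m - a = (1 - al) * L by rewrite mE addrC addKr.
  by rewrite /Cf mC [X in _ * X = _]addrC (mulrC _ L) -!mulrA (mulrCA (1 - al)).
have DE : (b - m) * (s + 1)^-1 *
    (`|f^`()%classic m| `^ q + `|f^`()%classic b| `^ q) =
    L * (s + 1)^-1 * Df f al q a b.
  have -> : b - m = al * L by rewrite mE' opprB addrC subrK.
  by rewrite /Df mC (mulrC _ L) -!mulrA (mulrCA al).
rewrite hE1 CE powR_scale_bound// in H1; rewrite hE2 DE powR_scale_bound// in H2.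
have {}H1 := H1 (measurable_itv _) (lexx _).
have {}H2 := H2 (measurable_itv _) (lexx _).
clearbody I1 I2.
rewrite IfE normrM.
have -> : `|L^-1| = L^-1 by rewrite gtr0_norm// invr_gt0.
rewrite (ler_pdivrMl _ _ L0).
by rewrite (le_trans (ler_normD _ _))// (le_trans (lerD H1 H2))// -!mulrDr.
Qed.

Theorem theorem2p3 (R : realType) (I : interval R) (f : R -> R)
  (a b al la s q p : R)
  (hdiff : forall x, interior [set` I] x -> derivable f x 1)
  (ha : interior [set` I] a) (hb : interior [set` I] b) (hab : a < b)
  (hint : lebesgue_measure.-integrable `[a, b] (EFin \o (derive1 f)))
  (hal0 : 0 <= al) (hal1 : al <= 1) (hla0 : 0 <= la) (hla1 : la <= 1)
  (hs0 : 0 < s) (hs1 : s <= 1) (hq : 1 < q) (hpq : p^-1 + q^-1 = 1)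
  (hconv : sconvex_on s (fun x => `|(derive1 f) x| `^ q) a b) :
  let M := (b - a) * (p + 1)^-1 `^ p^-1 * (s + 1)^-1 `^ q^-1 in
  (al * la <= 1 - al -> 1 - al <= 1 - la * (1 - al) ->
     `|If f la al a b| <= M *
       ((eps1 al la p) `^ p^-1 * (Cf f al q a b) `^ q^-1
        + (eps1 (1 - al) la p) `^ p^-1 * (Df f al q a b) `^ q^-1)) /\
  (al * la <= 1 - la * (1 - al) -> 1 - la * (1 - al) <= 1 - al ->
     `|If f la al a b| <= M *
       ((eps1 al la p) `^ p^-1 * (Cf f al q a b) `^ q^-1
        + (eps2 (1 - al) la p) `^ p^-1 * (Df f al q a b) `^ q^-1)) /\
  (1 - al <= al * la -> al * la <= 1 - la * (1 - al) ->
     `|If f la al a b| <= M *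
       ((eps2 al la p) `^ p^-1 * (Cf f al q a b) `^ q^-1
        + (eps1 (1 - al) la p) `^ p^-1 * (Df f al q a b) `^ q^-1)).
Proof.
(* 1/p = 1 - 1/q is positive because [q] exceeds 1. *)
have p0 : 0 < p.
  rewrite -invr_gt0; have := hpq; have : q^-1 < 1 by rewrite invf_lt1// (lt_trans _ hq).
  by move=> ? ?; lra.
have q0 : 0 < q by rewrite (lt_trans _ hq).
have df : {in `[a, b], forall x, derivable f x 1}.
  by move=> x xab; apply: hdiff; exact: interior_itv_convex ha hb xab.
have mf' : measurable_fun `[a, b] f^`()%classic.
  by apply/measurable_EFinP; exact: measurable_int hint.
move=> M; set L := b - a in M *; set m := al * a + (1 - al) * b.
have L0 : 0 < L by rewrite subr_gt0.
have bound := @If_le R f a b al la s q p hab hal0 hal1 hs0 p0 q0 hpq df mf' hconv.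
have scale x : 0 <= x -> (L * x) `^ (p + 1) = L `^ (p + 1) * x `^ (p + 1).
  by move=> x0; rewrite powRM// ltW.
have am : a <= m.
  have -> : m = a + (1 - al) * L by rewrite /m /L; ring.
  by rewrite lerDl mulr_ge0 ?subr_ge0// ltW.
have mb : m <= b.
  have -> : m = b - al * L by rewrite /m /L; ring.
  by rewrite gerBl mulr_ge0// ltW.
have u0 : 0 <= al * la by exact: mulr_ge0.
have v0 : 0 <= (1 - al) * la by rewrite mulr_ge0 ?subr_ge0.
pose k1 := a + al * la * L; pose k2 := b - (1 - al) * la * L.
have k1a : k1 - a = L * (al * la) by rewrite /k1; ring.
have bk2 : b - k2 = L * ((1 - al) * la) by rewrite /k2; ring.
have mk1 : m - k1 = L * (1 - al - al * la) by rewrite /k1 /m /L; ring.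
have k2m : k2 - m = L * (1 - (1 - al) - (1 - al) * la) by rewrite /k2 /m /L; ring.
have ak1 : a <= k1 by rewrite -subr_ge0 k1a mulr_ge0// ltW.
have k2b : k2 <= b by rewrite -subr_ge0 bk2 mulr_ge0// ltW.
have epsge0 x : 0 <= eps1 x la p by rewrite /eps1 addr_ge0 ?powR_ge0.
(* The hypotheses place the second base x la - (1 - x) between 0 and x la, where the power is
   monotone. *)
have eps2ge0 x : 1 - x <= x * la -> x <= 1 -> 0 <= eps2 x la p.
  move=> x0 x1; have E : x * la - 1 + x = x * la - (1 - x) by rewrite opprB -addrA (addrC x).
  rewrite /eps2 subr_ge0 E; apply: ge0_ler_powR; rewrite ?nnegrE ?subr_ge0//.
  - by rewrite addr_ge0// ltW.
  - by rewrite (le_trans _ x0)// subr_ge0.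
  - by rewrite gerBl subr_ge0.
(* Since m - k1 = L (1 - al - al la), comparing al la with 1 - al is comparing [k1] with [m]. *)
have in1 : al * la <= 1 - al ->
    Rintegral lebesgue_measure `[a, m] (fun x => `|x - k1| `^ p) =
    (p + 1)^-1 * (L `^ (p + 1) * eps1 al la p).
  move=> h; have h' : 0 <= 1 - al - al * la by rewrite subr_ge0.
  have k1m : k1 <= m by rewrite -subr_ge0 mk1 mulr_ge0// ltW.
  by rewrite (Rintegral_powR_in _ _ _ _ _ p0 ak1 k1m) k1a mk1 !scale// -mulrDr.
have out1 : 1 - al <= al * la ->
    Rintegral lebesgue_measure `[a, m] (fun x => `|x - k1| `^ p) =
    (p + 1)^-1 * (L `^ (p + 1) * eps2 al la p).
  move=> h; have h' : 0 <= al * la - 1 + al by rewrite -addrA (addrC (-1)) -opprB subr_ge0.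
  have k1m : k1 - m = L * (al * la - 1 + al) by rewrite /k1 /m /L; ring.
  have mk : m <= k1 by rewrite -subr_ge0 k1m mulr_ge0// ltW.
  by rewrite (Rintegral_powR_out _ _ _ _ _ p0 am mk) k1a k1m !scale// -mulrBr.
(* The hypothesis amounts to (1 - al) la <= al, that is to m <= k2. *)
have in2 : 1 - al <= 1 - la * (1 - al) ->
    Rintegral lebesgue_measure `[m, b] (fun x => `|x - k2| `^ p) =
    (p + 1)^-1 * (L `^ (p + 1) * eps1 (1 - al) la p).
  rewrite lerD2l lerN2 mulrC => h.
  have h' : 0 <= 1 - (1 - al) - (1 - al) * la by rewrite subKr subr_ge0.
  have mk : m <= k2 by rewrite -subr_ge0 k2m mulr_ge0// ltW.
  rewrite (Rintegral_powR_in _ _ _ _ _ p0 mk k2b) bk2 k2m !scale// -mulrDr.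
  by rewrite [X in _ * (_ * X)]addrC.
have out2 : 1 - la * (1 - al) <= 1 - al ->
    Rintegral lebesgue_measure `[m, b] (fun x => `|x - k2| `^ p) =
    (p + 1)^-1 * (L `^ (p + 1) * eps2 (1 - al) la p).
  rewrite lerD2l lerN2 mulrC => h.
  have h' : 0 <= (1 - al) * la - 1 + (1 - al) by rewrite addrA subrK subr_ge0.
  have mk2 : m - k2 = L * ((1 - al) * la - 1 + (1 - al)) by rewrite /k2 /m /L; ring.
  have km : k2 <= m by rewrite -subr_ge0 mk2 mulr_ge0// ltW.
  by rewrite (Rintegral_powR_left _ _ _ _ _ p0 km mb) bk2 mk2 !scale// -mulrBr.
(* In the last two cases the position of one of [k1], [k2] follows from the chain of inequalities by
   transitivity. *)
split; [|split] => h1 h2.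
- by apply: bound; [exact: in1|exact: in2|exact: epsge0|exact: epsge0].
- apply: bound; [exact: in1 (le_trans h1 h2)|exact: out2|exact: epsge0|].
  apply: eps2ge0; last by rewrite gerBl.
  by move: h2; rewrite subKr lerD2l lerN2 mulrC.
- by apply: bound; [exact: out1|exact: in2 (le_trans h1 h2)|exact: eps2ge0|exact: epsge0].
Qed.
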